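(* Let $\{\mu_n\}_{n=1}^\infty$ be a sequence of probability measures on $\mathbb{R}$ with finite moments, and write $d\mu_n(x)=w_n(x)\,dx+d\mu_{n,\mathrm{sing}}(x)$. Let $x^*\in I$ for some interval $I$ with $I\subseteq \mathrm{supp}(\mu_n)$ for all $n$, so that: (i) for all $n$, $\mu_{n,\mathrm{sing}}(I)=0$ and $w_n(x^* )>0$; (ii) there exists a function $\rho$, continuous on $I$ and satisfying $\rho(x^* )>0$, so that uniformly for $x \in I$, $$\frac{\widetilde{K}_n(x,x)}{n} \rightarrow \rho(x)\quad\text{as } n \rightarrow \infty;$$ (iii) uniformly for $x \in I$ and $a,b$ in compact sets in $\mathbb{R}$, $$\frac{\widetilde{K}_n \left(x+\frac{a}{\widetilde{K}_n(x,x)},x+\frac{b}{\widetilde{K}_n(x,x)}\right)}{\widetilde{K}_n(x,x)} \rightarrow \frac{\sin \pi\left(b-a \right)}{\pi \left(b-a \right)}\quad\text{as } n \rightarrow \infty.$$ Then for any $0 \leq \alpha <1$, $\{\mu_n\}_{n=1}^\infty$ satisfies the $\alpha$-Nevai condition at $x^*$.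
   Context: All measures have infinite support. $w_n$ is the density of the absolutely continuous part of $\mu_n$ and $\mu_{n,\mathrm{sing}}$ its singular part with respect to Lebesgue measure. $K_n(x,y)=\sum_{j=0}^{n-1}p_j(x)p_j(y)$ is the $n$-th Christoffel-Darboux kernel of $\mu_n$ ($p_j$ the orthonormal polynomials of $\mu_n$), and $\widetilde K_n(x,y)=w_n(x)^{1/2}w_n(y)^{1/2}K_n(x,y)$. The function $\sin(\pi u)/(\pi u)$ is taken to be $1$ at $u=0$. $\alpha$-Nevai condition at $x^*$: for any continuous compactly supported $f:\mathbb{R}\to\mathbb{R}$, $$\lim_{n\to\infty}\int\big(f(s)-f(n^\alpha(y-x^* ))\big)\frac{K_n\left(x^*+\frac{s}{n^\alpha},y\right)^2}{K_n\left(x^*+\frac{s}{n^\alpha},x^*+\frac{s}{n^\alpha}\right)}\,d\mu_n(y)=0$$ uniformly for $s$ in compact subsets of $\mathbb{R}$.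
   Formalization: The full α-Nevai condition is stated for 0<α<1 and x* interior to I; for α=0 or x* an endpoint of I, only for those s with x*+s/n^α in I, since the claim fails outside I (e.g. α=0, Lebesgue measure on [-1,1], s=5). *)

(* Defs.v *)
From HB Require Import structures.
From mathcomp Require Import all_boot all_order all_algebra.
From mathcomp Require Import all_classical all_reals all_analysis.

Set Implicit Arguments.
Unset Strict Implicit.
Unset Printing Implicit Defensive.

Import Order.TTheory GRing.Theory Num.Theory.
Import numFieldNormedType.Exports.

Local Open Scope classical_set_scope.
Local Open Scope ring_scope.

Section Measures.
Context {R : realType}.
Implicit Type mu : {measure set (measurableTypeR R) -> \bar R}.

Definition msupp mu : set R :=
  [set x | forall U : set R, open U -> U x -> (0 < mu U)%E].

Definition finite_moments mu : Prop :=
  forall k : nat, mu.-integrable setT (fun x : measurableTypeR R => (x ^+ k)%:E).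

(* d mu = w dx + d nu with nu singular to Lebesgue measure.  Any version w of
   the density is allowed; pointwise conditions on w refer to that version. *)
Definition lebesgue_decomposition mu (w : R -> R) nu : Prop :=
  [/\ measurable_fun setT (w : measurableTypeR R -> measurableTypeR R),
      forall x, 0 <= w x,
      forall A : set (measurableTypeR R), measurable A ->
        mu A = (\int[lebesgue_measure]_(x in A) (w x)%:E + nu A)%E &
      exists N : set (measurableTypeR R),
        [/\ measurable N, lebesgue_measure N = 0%E & nu (~` N) = 0%E] ].

(* For a measure with finite moments and infinite support, this determines
   the sequence p uniquely. *)
Definition orthonormal_polys mu (p : nat -> {poly R}) : Prop :=
  (forall j, size (p j) = j.+1 /\ 0 < lead_coef (p j)) /\
  (forall i j, (\int[mu]_x ((p i).[x] * (p j).[x])%:E = ((i == j)%:R)%:E)%E).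

End Measures.

Section Kernels.
Context {R : realType}.

Definition CD (p : nat -> {poly R}) (n : nat) (x y : R) : R :=
  \sum_(j < n) (p j).[x] * (p j).[y].

Definition wCD (w : R -> R) (p : nat -> {poly R}) (n : nat) (x y : R) : R :=
  Num.sqrt (w x) * Num.sqrt (w y) * CD p n x y.

Definition sinc_pi (u : R) : R :=
  if u == 0 then 1 else sin (pi * u) / (pi * u).

(* The points x + a / K(x, x) may leave the interval in which x ranges. *)
Definition rescaled (K : R -> R -> R) (x a b : R) : R :=
  K (x + a / K x x) (x + b / K x x) / K x x.

End Kernels.

Section Nevai.
Context {R : realType}.
(* the n-th measure and its orthonormal polynomials *)
Variables (mu : nat -> probability (measurableTypeR R) R)
          (p : nat -> nat -> {poly R}).

Definition Nevai_point (alpha xs : R) (n : nat) (s : R) : R :=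
  xs + s / n%:R `^ alpha.

Definition Nevai_int (alpha xs : R) (f : R -> R) (n : nat) (s : R) : R :=
  let x := Nevai_point alpha xs n s in
  \int[mu n]_y ((f s - f (n%:R `^ alpha * (y - xs))) *
                (CD (p n) n x y ^+ 2 / CD (p n) n x x)).

Definition compactly_supported (f : R -> R) : Prop :=
  compact (closure [set x | f x != 0]).

Definition alpha_Nevai (alpha xs : R) : Prop :=
  forall f : R -> R, continuous f -> compactly_supported f ->
  forall S : set R, compact S ->
    {uniform S, Nevai_int alpha xs f @ \oo --> (fun _ : R => 0 : R)}.

(* The same limit, with the uniformity only over the s in S whose evaluation
   point xs + s / n ^ alpha lies in I.  If alpha > 0 and xs is interior to I,
   then for every compact S all s in S qualify as soon as n is large, so this
   is alpha_Nevai.  If alpha = 0 the evaluation point xs + s does not move with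
   n, and alpha_Nevai also constrains the measures at points far from I, where
   nothing is assumed on them. *)
Definition alpha_Nevai_in (I : set R) (alpha xs : R) : Prop :=
  forall f : R -> R, continuous f -> compactly_supported f ->
  forall S : set R, compact S ->
  forall e : R, 0 < e ->
    \forall n \near \oo, forall s, S s -> I (Nevai_point alpha xs n s) ->
      `|Nevai_int alpha xs f n s| < e.

End Nevai.

(* Main.v *)
(** Since the [p j] are orthonormal, [CD(x, y)^2 / CD(x, x) dmu_n(y)] is a
probability measure for every [x], and the Nevai integral at [x] averages
[f(s) - f(n^alpha (y - xstar))] against it. The sine limit identifies the part
of this measure coming from [w_n dy], at scale [1 / K(x, x)] around [x], with
[sinc^2], whose total integral is 1; hence almost all of the mass lies within
[O(1 / K(x, x))] of [x]. It remains that [K(x, x)] is much larger than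
[n^alpha] near [xstar], which again follows from the sine limit, because
[K(xstar, xstar)] grows like [n]. The integral of [sinc^2] is bounded below by
comparison with the Fejer kernel. *)

Require Import Defs.
From HB Require Import structures.
From mathcomp Require Import all_boot all_order all_algebra.
From mathcomp Require Import all_classical all_reals all_analysis.
From mathcomp Require Import measurable_realfun ring lra.

Set Implicit Arguments.
Unset Strict Implicit.
Unset Printing Implicit Defensive.

Import Order.TTheory GRing.Theory Num.Theory.
Import numFieldNormedType.Exports.

Local Open Scope classical_set_scope.
Local Open Scope ring_scope.

(** * The Fejer kernel: closed form, comparison with sinc^2, integral over a period *)

Section FejerKernel.
Context {R : realType}.
Implicit Types (N n : nat) (t : R).

(** The Dirichlet kernel at angle 2t, i.e. the sum of exp(2ikt) over |k| <= n. *)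
Definition dirichlet n t : R := 1 + \sum_(k < n) 2 * cos (2 * k.+1%:R * t).

(** Not averaged over [N]: the closed form is sin(Nt)^2 / sin(t)^2, with value N^2 at 0. *)
Definition fejer N t : R := \sum_(j < N) dirichlet j t.

(** Telescoping: 2 sin(t) cos(2kt) = sin((2k+1)t) - sin((2k-1)t). *)
Lemma sin_dirichlet n t : sin t * dirichlet n t = sin (n.*2.+1%:R * t).
Proof.
elim: n => [|n IH]; first by rewrite /dirichlet big_ord0 addr0 mulr1 mul1r.
rewrite /dirichlet big_ord_recr /= addrA mulrDr -/(dirichlet n t) IH.
have -> : (n.*2.+1%:R : R) * t = 2 * n.+1%:R * t - t.
  by rewrite -muln2 !mulrS natrM; ring.
have -> : (n.+1.*2.+1%:R : R) * t = 2 * n.+1%:R * t + t.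
  by rewrite -muln2 mulrS natrM; ring.
by rewrite sinB sinD; ring.
Qed.

(** Telescoping again: sin(t) sin((2N+1)t) = sin((N+1)t)^2 - sin(Nt)^2. *)
Lemma sin2_fejer N t : sin t ^+ 2 * fejer N t = sin (N%:R * t) ^+ 2.
Proof.
elim: N => [|N IH]; first by rewrite /fejer big_ord0 mulr0 mul0r sin0 expr0n.
rewrite /fejer big_ord_recr /= mulrDr -/(fejer N t) IH.
rewrite expr2 -mulrA sin_dirichlet.
have -> : (N.*2.+1%:R : R) * t = N%:R * t + (N%:R * t + t).
  by rewrite -addnn mulrS natrD; ring.
have -> : (N.+1%:R : R) * t = N%:R * t + t by rewrite mulrS; ring.
rewrite [in LHS](sinD (N%:R * t)) !sinD !cosD.
have E : cos t ^+ 2 = 1 - sin t ^+ 2 by rewrite -(cos2Dsin2 t) addrK.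
by ring: E.
Qed.

Lemma dirichlet_le n t : dirichlet n t <= n.*2.+1%:R.
Proof.
rewrite -muln2 mulrS natrM lerD2l.
apply: (le_trans (y := \sum_(k < n) 2)).
  by apply: ler_sum => k _; have := cos_le1 (2 * k.+1%:R * t); lra.
by rewrite sumr_const card_ord -[X in X <= _]mulr_natl.
Qed.

Lemma fejer_le N t : fejer N t <= N%:R ^+ 2.
Proof.
elim: N => [|N IH]; first by rewrite /fejer big_ord0 expr0n.
rewrite /fejer big_ord_recr /= -/(fejer N t).
have := dirichlet_le N t; rewrite -muln2 !mulrS natrM => D.
move: IH D; set a := fejer _ _; set b := dirichlet _ _; set c : R := N%:R.
nra.
Qed.

Lemma ge0_mulr_cos_le_sin t : 0 <= t <= pi / 2 -> t * cos t <= sin t.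
Proof.
move=> /andP[t0 tpi].
pose f (u : R) := sin u - u * cos u.
have df (u : R) : is_derive u 1 f (u * sin u).
  by rewrite /f; apply: is_derive_eq; rewrite /GRing.scale /=; ring.
have : f 0 <= f t.
  apply: (@ger0_derive1_le_cc _ f 0 (pi / 2)) => //.
  - move=> u /[!in_itv] /= /andP[u0 u1]; have [_] := df u; rewrite derive1E => ->.
    by rewrite mulr_ge0 ?ltW // sin_gt0_pihalf // u0.
  - by apply: derivable_within_continuous => u _; have [] := df u.
  - by rewrite in_itv /= lexx divr_ge0 // pi_ge0.
  - by rewrite in_itv /= t0.
by rewrite /f sin0 mul0r subrr subr_ge0.
Qed.

(** Squaring t cos(t) <= sin(t). For t != 0 this reads 1/sin(t)^2 <= 1/t^2 + 1, so replacing
    sin(t)^2 by t^2 in the Fejer denominator costs at most 1. *)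
Lemma sqr_le_sin2 t : `|t| <= pi / 2 -> t ^+ 2 <= sin t ^+ 2 * (1 + t ^+ 2).
Proof.
move=> tpi.
have E : sin t ^+ 2 = sin `|t| ^+ 2.
  by case: (ler0P t) => _; rewrite ?sinN ?sqrrN.
rewrite E -(real_normK (num_real t)).
have : 0 <= `|t| <= pi / 2 by rewrite normr_ge0.
move: `|t| => {E tpi} u u0.
have S := ge0_mulr_cos_le_sin u0.
have c0 : 0 <= cos u by apply: cos_ge0_pihalf; move: u0 => /andP[]; have := pi_gt0 R; lra.
have [u00 _] := andP u0.
have : (u * cos u) ^+ 2 <= sin u ^+ 2.
  by rewrite ler_sqr ?nnegrE ?(le_trans _ S) ?mulr_ge0.
rewrite exprMn; have -> : cos u ^+ 2 = 1 - sin u ^+ 2 by rewrite -(cos2Dsin2 u); ring.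
by rewrite mulrBr mulr1 lerBlDr => H; rewrite mulrDr mulr1 [X in _ + X]mulrC.
Qed.

Lemma fejer_ge0 N t : `|t| <= pi / 2 -> 0 <= fejer N t.
Proof.
move=> tpi; have [->|t0] := eqVneq t 0.
  apply: sumr_ge0 => j _; rewrite addr_ge0 //; apply: sumr_ge0 => k _.
  by rewrite mulr0 cos0 mulr1.
rewrite -(@pmulr_rge0 _ (sin t ^+ 2)) ?sin2_fejer ?sqr_ge0 //.
rewrite lt_def sqr_ge0 andbT; apply/eqP => s0.
have := sqr_le_sin2 tpi; rewrite s0 mul0r le_eqVlt ltNge sqr_ge0 orbF.
by rewrite sqrf_eq0 (negbTE t0).
Qed.

(** For t != 0 the sinc term is sin(Nt)^2 / t^2, and [sqr_le_sin2] bounds the excess of the Fejer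
    kernel over it by sin(Nt)^2 <= 1. *)
Lemma fejer_le_sinc N t : (0 < N)%N -> `|t| <= pi / 2 ->
  fejer N t <= N%:R ^+ 2 * sinc_pi (N%:R * t / pi) ^+ 2 + 1.
Proof.
move=> N0 tpi; have [->|t0] := eqVneq t 0.
  rewrite /sinc_pi mulr0 mul0r eqxx expr1n mulr1.
  by have := fejer_le N 0; lra.
have pi0 : (pi : R) != 0 by rewrite gt_eqF ?pi_gt0.
have N0' : (N%:R : R) != 0 by rewrite pnatr_eq0 -lt0n.
have -> : sinc_pi (N%:R * t / pi) = sin (N%:R * t) / (N%:R * t).
  rewrite /sinc_pi ifF; last first.
    by rewrite !mulf_eq0 invr_eq0 (negbTE t0) (negbTE N0') (negbTE pi0).
  by rewrite [pi * _]mulrC divfK.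
rewrite exprMn -sin2_fejer.
have -> : N%:R ^+ 2 * (sin t ^+ 2 * fejer N t * (N%:R * t)^-1 ^+ 2) =
  sin t ^+ 2 * fejer N t / t ^+ 2 by field; rewrite t0 N0'.
have t20 : 0 < t ^+ 2 by rewrite exprn_even_gt0.
rewrite -lerBlDr ler_pdivlMr // mulrBl mul1r.
have S := sqr_le_sin2 tpi.
have S1 : sin t ^+ 2 * fejer N t <= 1.
  by rewrite sin2_fejer sin2cos2 gerBl sqr_ge0.
have F0 := fejer_ge0 N tpi.
rewrite [fejer N t * _]mulrC.
move: (fejer N t) S S1 F0 t20 => F; move: (sin t ^+ 2) (t ^+ 2) => s u S S1 F0 u0.
nra.
Qed.


Lemma fejer_eq N t : fejer N t =
  N%:R + \sum_(j < N) \sum_(k < j) 2 * cos (2 * k.+1%:R * t).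
Proof.
by rewrite /fejer /dirichlet big_split /= sumr_const card_ord.
Qed.

Lemma continuous_fejer N : continuous (@fejer N).
Proof.
rewrite (_ : fejer N = fun t =>
  N%:R + \sum_(j < N) \sum_(k < j) 2 * cos (2 * k.+1%:R * t)); last first.
  by apply/funext => t; rewrite fejer_eq.
move=> t; apply: cvgD; first exact: cvg_cst.
apply: cvg_big => [|j _]; first exact: add_continuous.
apply: cvg_big => [|k _]; first exact: add_continuous.
apply: cvgMr; apply: (continuous_comp _ (@continuous_cos _ _)).
by apply: cvgMr; exact: cvg_id.
Qed.

Lemma is_derive_sumf n (h : 'I_n -> R -> R) (dh : 'I_n -> R) (y : R) :
  (forall i, is_derive y 1 (h i) (dh i)) ->
  is_derive y 1 (fun z => \sum_(i < n) h i z) (\sum_(i < n) dh i).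
Proof. by move=> dhi; rewrite -fct_sumE; exact: is_derive_sum. Qed.

Lemma sin_natpi n : sin (n%:R * pi) = 0 :> R.
Proof.
by rewrite mulr_natl -[_ *+ _]add0r alternatingn ?sin0 ?mulr0 //; exact: sinDpi.
Qed.

(* A full period is [pi / c] long, over which every cosine integrates to 0. *)
Lemma integral_fejer N (c x : R) : 0 < c ->
  (\int[lebesgue_measure]_(y in `[(x - pi / (2 * c))%R, (x + pi / (2 * c))%R])
     (fejer N (c * (y - x)))%:E = (N%:R * pi / c)%:E)%E.
Proof.
move=> c0; pose r := pi / (2 * c).
pose G (y : R) : R := N%:R * y +
  \sum_(j < N) \sum_(k < j) (k.+1%:R * c)^-1 * sin (2 * k.+1%:R * (c * (y - x))).
have dG (y : R) : is_derive y 1 G (fejer N (c * (y - x))).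
  rewrite fejer_eq; apply: is_deriveD.
    by apply: is_derive_eq; rewrite /GRing.scale /= mulr1.
  apply: is_derive_sumf => j; apply: is_derive_sumf => k.
  have k0 : k.+1%:R * c != 0 by rewrite mulf_neq0 ?gt_eqF // pnatr_eq0.
  apply: is_derive_eq; rewrite /GRing.scale /=; field.
  by rewrite gt_eqF //= nat1r pnatr_eq0.
have cf : continuous (fun y => fejer N (c * (y - x)) : R).
  move=> y; apply: (@continuous_comp _ _ _ (fun y => c * (y - x)) (fejer N)).
    by apply: differentiable_continuous; exact/derivable1_diffP.
  exact: continuous_fejer.
have r0 : 0 < r by rewrite divr_gt0 ?pi_gt0 // mulr_gt0.
have rx : x - r < x + r by lra.
rewrite (@continuous_FTC2 _ _ G) //.
- rewrite -EFinB; congr EFin; rewrite /G.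
  set S1 := \sum_(j < N) _; set S2 := \sum_(j < N) _.
  have -> : S1 = 0.
    rewrite /S1 big1 // => j _; rewrite big1 // => k _.
    have -> : 2 * k.+1%:R * (c * (x + r - x)) = k.+1%:R * pi.
      by rewrite /r; field; rewrite gt_eqF.
    by rewrite sin_natpi mulr0.
  have -> : S2 = 0.
    rewrite /S2 big1 // => j _; rewrite big1 // => k _.
    have -> : 2 * k.+1%:R * (c * (x - r - x)) = - (k.+1%:R * pi).
      by rewrite /r; field; rewrite gt_eqF.
    by rewrite sinN sin_natpi oppr0 mulr0.
  by rewrite /r; field; rewrite gt_eqF.
- exact: continuous_subspaceT.
- split=> [y _||]; first by have [] := dG y.
  + apply: cvg_at_right_filter; apply: differentiable_continuous.
    by apply/derivable1_diffP; have [] := dG (x - r).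
  + apply: cvg_at_left_filter; apply: differentiable_continuous.
    by apply/derivable1_diffP; have [] := dG (x + r).
- by move=> y _; rewrite derive1E; have [_ ->] := dG y.
Qed.

End FejerKernel.

(** * Integrals against a measure that dominates a density *)

Section Density.
Context d (T : measurableType d) (R : realType).
Variables (lam mu : {measure set T -> \bar R}) (w : T -> R).
Hypotheses (mw : measurable_fun setT w) (w0 : forall x, 0 <= w x).
Hypothesis wmu : forall A, measurable A ->
  (\int[lam]_(x in A) (w x)%:E <= mu A)%E.

Import HBNNSimple.
Local Open Scope ereal_scope.

(** Both integrals are finite sums over the level sets of [h], compared term by term through
    [wmu]. *)
Let density_le_nnsfun (h : {nnsfun T >-> R}) (D : set T) : measurable D ->
  \int[lam]_(x in D) (h x * w x)%:E <= \int[mu]_(x in D) (h x)%:E.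
Proof.
move=> mD.
have mwE : measurable_fun [set: T] (EFin \o w) by exact/measurable_EFinP.
have -> : \int[mu]_(x in D) (h x)%:E =
    \sum_(y \in range h) y%:E * mu (D `&` h @^-1` [set y]).
  under eq_integral do rewrite fimfunE -fsumEFin //.
  rewrite ge0_integral_fsum //; last 2 first.
  - by move=> y; apply: measurable_funTS; apply/measurable_EFinP; exact: measurable_funM.
  - by move=> y x _; exact: nnfun_muleindic_ge0.
  apply: eq_fsbigr => y _.
  under eq_integral do rewrite EFinM.
  by rewrite integralZl_indic_nnsfun // integral_indic // setIC.
have -> : \int[lam]_(x in D) (h x * w x)%:E =
    \sum_(y \in range h) y%:E * \int[lam]_(x in D `&` h @^-1` [set y]) (w x)%:E.
  under eq_integral => x _.
    rewrite EFinM fimfunE -fsumEFin // ge0_mule_fsuml; last first.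
      by move=> y; exact: nnfun_muleindic_ge0.
    over.
  rewrite ge0_integral_fsum //; last 2 first.
  - move=> y; apply: measurable_funTS; apply: emeasurable_funM => //.
    by apply/measurable_EFinP; exact: measurable_funM.
  - by move=> y x _; rewrite mule_ge0 ?lee_fin // -lee_fin nnfun_muleindic_ge0.
  apply: eq_fsbigr => y; rewrite inE => -[t _ <-].
  under eq_integral do rewrite EFinM -muleA.
  rewrite ge0_integralZl //; last 3 first.
  - apply: measurable_funTS; apply: emeasurable_funM => //.
    exact/measurable_EFinP.
  - by move=> x _; rewrite mule_ge0 ?lee_fin.
  - by rewrite lee_fin.
  congr (_ * _); under eq_integral do rewrite muleC.
  rewrite integral_mkcondr; apply: eq_integral => x _.
  by rewrite epatch_indic.
apply: lee_fsum => // y [t _ <-].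
by apply: lee_wpmul2l; [rewrite lee_fin | apply: wmu; exact: measurableI].
Qed.

(** Monotone convergence along simple functions increasing to [f]. *)
Lemma density_le_integral (f : T -> R) (D : set T) : measurable D ->
  measurable_fun D f -> (forall x, (0 <= f x)%R) ->
  \int[lam]_(x in D) (f x * w x)%:E <= \int[mu]_(x in D) (f x)%:E.
Proof.
move=> mD mf f0.
have mwD : measurable_fun D w by exact: measurable_funTS.
have mfE : measurable_fun D (EFin \o f : T -> \bar R) by exact/measurable_EFinP.
pose h := nnsfun_approx mD mfE.
have hf x : D x -> EFin \o h^~ x @ \oo --> (f x)%:E.
  by move=> Dx; apply: cvg_nnsfun_approx => // y _; rewrite lee_fin.
have mh n : measurable_fun D (h n) by exact: measurable_funTS.
have ndh x m n : (m <= n)%N -> (h m x <= h n x)%R.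
  by move=> mn; exact/lefP/nd_nnsfun_approx.
have -> : \int[lam]_(x in D) (f x * w x)%:E =
    limn (fun n => \int[lam]_(x in D) (h n x * w x)%:E).
  rewrite -monotone_convergence //.
  - apply: eq_integral => x /[!inE] Dx; apply/esym/cvg_lim => //.
    under eq_fun do rewrite EFinM.
    by rewrite EFinM; apply: cvgeZr => //; exact: hf.
  - by move=> n; apply/measurable_EFinP; exact: measurable_funM.
  - by move=> n x _; rewrite lee_fin mulr_ge0.
  - by move=> x _ m n mn; rewrite lee_fin ler_wpM2r // ndh.
have -> : \int[mu]_(x in D) (f x)%:E = limn (fun n => \int[mu]_(x in D) (h n x)%:E).
  rewrite -monotone_convergence //.
  - by apply: eq_integral => x /[!inE] Dx; apply/esym/cvg_lim => //; exact: hf.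
  - by move=> n; apply/measurable_EFinP.
  - by move=> n x _; rewrite lee_fin.
  - by move=> x _ m n mn; rewrite lee_fin ndh.
apply: lee_lim.
- apply: ereal_nondecreasing_is_cvgn => m n mn; apply: ge0_le_integral => //.
  + by move=> x _; rewrite lee_fin mulr_ge0.
  + by apply/measurable_EFinP; exact: measurable_funM.
  + by apply/measurable_EFinP; exact: measurable_funM.
  + by move=> x _; rewrite lee_fin ler_wpM2r // ndh.
- apply: ereal_nondecreasing_is_cvgn => m n mn; apply: ge0_le_integral => //.
  + by move=> x _; rewrite lee_fin.
  + exact/measurable_EFinP.
  + exact/measurable_EFinP.
  + by move=> x _; rewrite lee_fin ndh.
- by apply: nearW => n; exact: density_le_nnsfun.
Qed.

End Density.

(** * The Christoffel-Darboux kernel as a polynomial, and its L^2 norm *)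

Section ChristoffelDarboux.
Context {R : realType}.
Variables (mu : {measure set (measurableTypeR R) -> \bar R}) (p : nat -> {poly R}).

Lemma integrable_horner (q : {poly R}) : finite_moments mu ->
  mu.-integrable setT (fun x : measurableTypeR R => (q.[x])%:E).
Proof.
move=> mom; under eq_fun do rewrite horner_coef -sumEFin.
apply: integrable_sum => // i _.
by under eq_fun do rewrite EFinM; apply: integrableZl.
Qed.

Lemma CD_horner n x y : CD p n x y = (\sum_(j < n) (p j).[x] *: p j).[y].
Proof. by rewrite /CD horner_sum; apply: eq_bigr => j _; rewrite hornerZ. Qed.

(** Expanding the square into a double sum, orthonormality leaves only the diagonal terms
    p_i(x)^2. *)
Lemma integral_CD_sqr n x : finite_moments mu -> orthonormal_polys mu p ->
  (\int[mu]_y (CD p n x y ^+ 2)%:E = (CD p n x x)%:E)%E.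
Proof.
move=> mom [_ ortho].
have E y : ((CD p n x y ^+ 2)%:E = \sum_(i < n) \sum_(j < n)
    ((p i).[x] * (p j).[x])%:E * ((p i).[y] * (p j).[y])%:E)%E.
  rewrite expr2 /CD mulr_suml -sumEFin; apply: eq_bigr => i _.
  rewrite mulr_sumr -sumEFin; apply: eq_bigr => j _.
  by rewrite -EFinM; congr EFin; ring.
have int i j : mu.-integrable setT (fun y : measurableTypeR R =>
    (((p i).[x] * (p j).[x])%:E * ((p i).[y] * (p j).[y])%:E)%E).
  apply: integrableZl => //; under eq_fun do rewrite -hornerM.
  exact: integrable_horner.
under eq_integral do rewrite E.
rewrite integral_sum //; last by move=> i; apply: integrable_sum.
rewrite /CD -sumEFin; apply: eq_bigr => i _.
rewrite integral_sum // (bigD1 i) //= big1 ?adde0 => [|j ji].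
  rewrite integralZl ?ortho ?eqxx ?mule1 //.
  by under eq_fun do rewrite -hornerM; exact: integrable_horner.
rewrite integralZl ?ortho; last first.
- by under eq_fun do rewrite -hornerM; exact: integrable_horner.
- by [].
have -> : (i == j :> nat) = false by apply/negbTE; rewrite eq_sym.
by rewrite mule0.
Qed.

End ChristoffelDarboux.

(** * An upper bound for sinc *)

Section Sinc.
Context {R : realType}.
Implicit Types u v : R.

Lemma normr_sin_le u : `|sin u| <= `|u|.
Proof.
wlog u0 : u / 0 <= u => [H|].
  have [/H//|u0] := leP 0 u.
  by rewrite -(normrN u) -(normrN (sin u)) -sinN H // oppr_ge0 ltW.
have [|c _] := @MVT_segment R sin cos 0 u u0.
  by apply: continuous_subspaceT; exact: continuous_sin.
by rewrite sin0 !subr0 => ->; rewrite normrM ler_piMl // cos_max.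
Qed.

Lemma sinc_pi_sqr_le1 u : sinc_pi u ^+ 2 <= 1.
Proof.
rewrite /sinc_pi; case: eqVneq => [_|u0]; first by rewrite expr1n.
have pu : pi * u != 0 by rewrite mulf_neq0 // gt_eqF ?pi_gt0.
rewrite -(real_normK (num_real _)) exprn_ile1 // normrM normfV.
by rewrite ler_pdivrMr ?normr_gt0 // mul1r normr_sin_le.
Qed.

End Sinc.

(** * Kernel mass near the diagonal, from the sine limit *)

Section Mass.
Context {R : realType}.
Variables (mu : {measure set (measurableTypeR R) -> \bar R}) (w : R -> R).
Variables (nu : {measure set (measurableTypeR R) -> \bar R}) (p : nat -> {poly R}).

Lemma wCD_diag n x : 0 <= w x -> wCD w p n x x = w x * CD p n x x.
Proof. by move=> w0; rewrite /wCD -expr2 sqr_sqrtr. Qed.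

Lemma CD_diag_ge0 n x : 0 <= CD p n x x.
Proof. by apply: sumr_ge0 => j _; rewrite -expr2 sqr_ge0. Qed.

(** With b = k (y - x), k the weighted diagonal, the rescaled second point is [y]; this expresses
    the density of the kernel mass through the quantity in the sine limit. *)
Lemma rescaled_sqr n x y : 0 <= w x -> 0 <= w y -> wCD w p n x x != 0 ->
  CD p n x y ^+ 2 * w y = CD p n x x * wCD w p n x x *
    rescaled (wCD w p n) x 0 (wCD w p n x x * (y - x)) ^+ 2.
Proof.
move=> wx0 wy0 k0; set k := wCD w p n x x.
have -> : rescaled (wCD w p n) x 0 (k * (y - x)) = wCD w p n x y / k.
  have e : k * (y - x) / k = y - x by rewrite mulrAC divff ?mul1r.
  by rewrite /rescaled -/k mul0r addr0 e addrC subrK.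
rewrite /wCD !exprMn !sqr_sqrtr //.
have kE : k = w x * CD p n x x by rewrite -wCD_diag.
move: k0; rewrite -/k; rewrite kE mulf_eq0 negb_or => /andP[wx K].
by field; rewrite wx K.
Qed.

(** On the window, the rescaled kernel squared is at least sinc^2 - 2 eps, and sinc^2 is at least (F
    - 1)/N^2 with F the Fejer kernel. The F term integrates to the full mass K = CD(x, x); the
    errors, over a window of length N/k, cost K (1/N + 2 N eps). *)
Lemma ball_mass (n N : nat) (x eps : R) :
  lebesgue_decomposition mu w nu -> (0 < N)%N -> 0 <= eps ->
  0 < wCD w p n x x ->
  (forall b, `|b| <= N%:R / 2 ->
     `|rescaled (wCD w p n) x 0 b - sinc_pi b| <= eps) ->
  let r := N%:R / (2 * wCD w p n x x) in
  ((CD p n x x * (1 - N%:R^-1 - 2 * N%:R * eps))%:E <=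
   \int[mu]_(y in `[(x - r)%R, (x + r)%R]) (CD p n x y ^+ 2)%:E)%E.
Proof.
move=> [mw w0 wmu _] N0 eps0 k0 sine /=; set k := wCD w p n x x.
rewrite -/k in k0; set K := CD p n x x; set r := N%:R / (2 * k).
have N0' : 0 < N%:R :> R by rewrite ltr0n.
have K0 : 0 <= K by exact: CD_diag_ge0.
have resc y : CD p n x y ^+ 2 * w y =
    K * k * rescaled (wCD w p n) x 0 (k * (y - x)) ^+ 2.
  by rewrite rescaled_sqr // gt_eqF.
clearbody k K.
have nk : k != 0 by rewrite gt_eqF.
have nN : N%:R != 0 :> R by rewrite gt_eqF.
have np : pi != 0 :> R by rewrite gt_eqF // pi_gt0.
have r0 : 0 < r by rewrite divr_gt0 ?mulr_gt0.
(* This scale makes the window exactly one period of the Fejer kernel and turns the sinc argument N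
   c (y - x) / pi into k (y - x). *)
pose c := pi * k / N%:R.
have c0 : 0 < c by rewrite divr_gt0 ?mulr_gt0 ?pi_gt0.
have rE : r = pi / (2 * c).
  by rewrite /r /c; move: pi np => P np; field; do ?[apply/andP; split].
pose D : set (measurableTypeR R) := `[x - r, x + r]%classic.
have mD : measurable D by exact: measurable_itv.
have Dr y : D y -> `|y - x| <= r by rewrite /D /= in_itv /= ler_norml; lra.
pose C := K * k * ((N%:R ^+ 2)^-1 + 2 * eps).
have C0 : 0 <= C by rewrite !mulr_ge0 ?addr_ge0 ?invr_ge0 ?mulr_ge0 ?sqr_ge0 // ltW.
(* Normalized so that [a] times the Fejer integral N pi / c is exactly [K]; [C] is the pointwise
   error. *)
pose a := K * k / N%:R ^+ 2.
have a0 : 0 <= a by rewrite divr_ge0 ?sqr_ge0 ?mulr_ge0 // ltW.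
have mCD : measurable_fun setT
    (fun y : measurableTypeR R => CD p n x y ^+ 2 : measurableTypeR R).
  under eq_fun do rewrite CD_horner.
  by apply: measurable_funX; apply: continuous_measurable_fun; exact: continuous_horner.
have mF : measurable_fun setT
    (fun y : measurableTypeR R => fejer N (c * (y - x)) : measurableTypeR R).
  apply: continuous_measurable_fun => y.
  apply: (@continuous_comp _ _ _ (fun y => c * (y - x)) (fejer N)).
    by apply: differentiable_continuous; exact/derivable1_diffP.
  exact: continuous_fejer.
have cy y : D y -> `|c * (y - x)| <= pi / 2.
  move=> /Dr h; rewrite normrM gtr0_norm //.
  have -> : pi / 2 = c * r by rewrite rE; field; rewrite gt_eqF.
  by rewrite ler_pM2l.
have low y : D y -> a * fejer N (c * (y - x)) <= CD p n x y ^+ 2 * w y + C.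
  move=> Dy; rewrite resc.
  have kb : `|k * (y - x)| <= N%:R / 2.
    rewrite normrM gtr0_norm //.
    have -> : N%:R / 2 = k * r by rewrite /r; field.
    by rewrite ler_pM2l // Dr.
  have := sine _ kb; have := fejer_le_sinc N0 (cy _ Dy).
  have -> : N%:R * (c * (y - x)) / pi = k * (y - x).
    by rewrite /c; move: pi np => P np; field; do ?[apply/andP; split].
  have := sinc_pi_sqr_le1 (k * (y - x)).
  set S := sinc_pi _; set Q := rescaled _ _ _ _; set F := fejer _ _.
  move=> S1 FS QS.
  (* S^2 - Q^2 = 2 S (S - Q) - (S - Q)^2, with |S| <= 1. *)
  have QS2 : S ^+ 2 <= Q ^+ 2 + 2 * eps.
    have S1' : `|S| <= 1 by rewrite -(@expr_le1 _ 2) // real_normK // num_real.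
    have : S * (S - Q) <= eps.
      rewrite (le_trans (ler_norm _)) // normrM distrC.
      by rewrite (le_trans _ QS) // ler_piMl.
    have := sqr_ge0 (S - Q); nra.
  have : F / N%:R ^+ 2 <= Q ^+ 2 + ((N%:R ^+ 2)^-1 + 2 * eps).
    rewrite ler_pdivrMr ?exprn_gt0 // mulrDl mulrDl mulVf ?gt_eqF ?exprn_gt0 //.
    have : 0 < N%:R ^+ 2 :> R by rewrite exprn_gt0.
    move: (N%:R ^+ 2) FS => n2 FS n20; nra.
  have : 0 <= K * k by rewrite mulr_ge0 // ltW.
  rewrite /C /a => h /(ler_wpM2l h).
  by rewrite (_ : K * k * (F / _) = K * k / N%:R ^+ 2 * F) ?mulrDr //; ring.
have LD : lebesgue_measure D = (2 * r)%:E.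
  have := lebesgue_measure_itv `[x - r, x + r]; rewrite /= lte_fin ifT; last by lra.
  by rewrite -EFinB => E; rewrite [LHS]E; congr EFin; ring.
have I1 : (\int[lebesgue_measure]_(y in D) (a * fejer N (c * (y - x)))%:E = K%:E)%E.
  under eq_integral do rewrite EFinM.
  rewrite ge0_integralZl //.
  - rewrite /D rE integral_fejer // -EFinM /a /c; congr EFin; move: pi np => P np; field.
    by do ?[apply/andP; split].
  - by apply/measurable_EFinP; exact: measurable_funTS.
  - by move=> y /cy; rewrite lee_fin => /fejer_ge0.
have I2 : (\int[lebesgue_measure]_(y in D) (CD p n x y ^+ 2 * w y + C)%:E =
   \int[lebesgue_measure]_(y in D) (CD p n x y ^+ 2 * w y)%:E + (C * (2 * r))%:E)%E.
  under eq_integral do rewrite EFinD.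
  rewrite ge0_integralD //.
  - by rewrite integral_cst // (EFinM C) -LD.
  - by move=> y _; rewrite lee_fin mulr_ge0 ?sqr_ge0.
  - by apply/measurable_EFinP; apply: measurable_funTS; exact: measurable_funM.
have I3 : (K%:E <= \int[lebesgue_measure]_(y in D) (CD p n x y ^+ 2 * w y)%:E +
   (C * (2 * r))%:E)%E.
  rewrite -I1 -I2; apply: ge0_le_integral => //.
  - by move=> y Dy; rewrite lee_fin mulr_ge0 // fejer_ge0 // cy.
  - by apply/measurable_EFinP; apply: measurable_funTS; exact: measurable_funM.
  - apply/measurable_EFinP; apply: measurable_funTS; apply: measurable_funD => //.
    exact: measurable_funM.
have -> : K * (1 - N%:R^-1 - 2 * N%:R * eps) = K - C * (2 * r).
  by rewrite /C /r; field; do ?[apply/andP; split].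
(* Passing from [w] dy to [mu] can only add mass, that of [nu]. *)
rewrite EFinB leeBlDr //; apply: le_trans I3 _; apply: leeD => //.
apply: density_le_integral => //.
- by move=> A mA; rewrite wmu // leeDl.
- exact: measurable_funTS.
- by move=> y; rewrite sqr_ge0.
Qed.

End Mass.

(** * Averages against a concentrated probability density *)

Section Concentration.
Context d (T : measurableType d) (R : realType).
Variables (mu : {measure set T -> \bar R}) (g h : T -> R) (D : set T) (e M del : R).
Hypotheses (mD : measurable D) (ig : mu.-integrable setT (EFin \o g)).
Hypotheses (g0 : forall x, 0 <= g x) (mh : measurable_fun setT h).
Hypotheses (hM : forall x, `|h x| <= M) (he : forall x, D x -> `|h x| <= e).

(** Split at [D]: inside, |h| <= e against mass at most 1; outside, |h| <= M against mass at most
    [del]. *)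
Lemma Rintegral_concentrated : 0 <= e -> 0 <= M ->
  \int[mu]_x g x = 1 -> 1 - del <= \int[mu]_(x in D) g x ->
  `|\int[mu]_x (h x * g x)| <= e + M * del.
Proof.
move=> e0 M0 g1 gD.
have mg : measurable_fun setT g by apply/measurable_EFinP; exact: measurable_int ig.
have iMg c : mu.-integrable setT (fun x => (c * g x)%:E).
  by under eq_fun do rewrite EFinM; exact: integrableZl.
have ihg : mu.-integrable setT (fun x => (h x * g x)%:E).
  apply: (le_integrable measurableT _ _ (iMg M)).
    by apply/measurable_EFinP; exact: measurable_funM.
  move=> x _; rewrite /= lee_fin !normrM [`|M|]ger0_norm //.
  by rewrite ler_wpM2r.
have inhg : mu.-integrable setT (fun x => (`|h x * g x|)%:E).
  exact: (integrable_norm ihg).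
have sub A (f : T -> \bar R) :
    measurable A -> mu.-integrable setT f -> mu.-integrable A f.
  by move=> mA; apply: integrableS.
have mDC : measurable (~` D) by exact: measurableC.
have DT : setT = D `|` ~` D by rewrite setUv.
have DD : [disjoint D & ~` D] by apply/disj_setPCl.
apply: (le_trans (le_normr_Rintegral measurableT ihg)).
move: g1; rewrite DT !Rintegral_setU // -?DT // => g1.
have leD : \int[mu]_(x in D) `|h x * g x| <= e * \int[mu]_(x in D) g x.
  rewrite -RintegralZl //; last exact: sub.
  apply: le_Rintegral => //; [exact: sub|exact: (sub _ _ _ (iMg _))|].
  by move=> x Dx; rewrite normrM (ger0_norm (g0 x)) ler_wpM2r // he.
have leDC : \int[mu]_(x in ~` D) `|h x * g x| <= M * \int[mu]_(x in ~` D) g x.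
  rewrite -RintegralZl //; last exact: sub.
  apply: le_Rintegral => //; [exact: sub|exact: (sub _ _ _ (iMg _))|].
  by move=> x Dx; rewrite normrM (ger0_norm (g0 x)) ler_wpM2r.
have : 0 <= \int[mu]_(x in ~` D) g x by apply: Rintegral_ge0.
move: leD leDC g1 gD; set a := \int[mu]_(x in D) g x; set b := \int[mu]_(x in _) g x.
nra.
Qed.

End Concentration.

(** * Uniform convergence in epsilon form *)

Section UniformLimits.
Context {R : realType} {U : choiceType}.

Lemma uniform_cvg_normP (A : set U) (F : nat -> U -> R) (g : U -> R) :
  {uniform A, F @ \oo --> g} <->
  forall e : R, 0 < e -> \forall n \near \oo, forall y, A y -> `|g y - F n y| < e.
Proof.
split=> [Fg e e0|H].
  have := Fg [set f | forall y, A y -> `|g y - f y| < e]; apply.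
  apply/uniform_nbhs; exists [set xy | `|xy.1 - xy.2| < e]; split => //.
  by rewrite -entourage_ballE; exists e.
move=> P /uniform_nbhs[E [+ EP]]; rewrite -entourage_ballE => -[e /= e0 eE].
have := H e e0; apply: filterS => n Hn; apply: EP => y Ay.
by apply: eE; exact: Hn.
Qed.

End UniformLimits.

(** * Uniform continuity and boundedness of the test function *)

Section UniformContinuity.
Context {R : realType}.

(** Only [s] is confined to the compact set: [t] ranges over the whole line, as the Nevai integral
    samples [f] outside [S] too. *)
Lemma compact_continuous_uniform (f : R -> R) (S : set R) (e : R) :
  continuous f -> compact S -> 0 < e ->
  exists2 eta : R, 0 < eta & forall s t, S s -> `|s - t| <= eta -> `|f s - f t| <= e.
Proof.
move=> cf cS e0.
have e20 : 0 < e / 2 by rewrite divr_gt0.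
pose P (eta s : R) := forall t, `|s - t| <= eta -> `|f s - f t| <= e.
have near_P : \forall eta \near 0^'+, S `<=` P eta.
  apply: (compact_near_coveringP S).1 => // s Ss.
  have /cvgrPdist_lt /(_ _ e20) /nbhs_ballP[del /= del0 H] := cf s.
  have del20 : 0 < del / 2 by rewrite divr_gt0.
  (* Half radii keep both s' and any t within eta of s' inside the ball of radius [del] around
     [s]. *)
  exists (ball s (del / 2), [set eta | eta < del / 2]).
    by split; [exact: nbhsx_ballx | exact: nbhs_right_lt].
  move=> [s' eta] /= [+ etad] t st; rewrite -ball_normE /= => ss'.
  have h1 : `|f s - f s'| < e / 2 by apply: H; rewrite -ball_normE /=; lra.
  have h2 : `|f s - f t| < e / 2.
    apply: H; rewrite -ball_normE /=; have := ler_distD s' s t; lra.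
  by have := ler_distD (f s) (f s') (f t); rewrite [`|f s' - f s|]distrC; lra.
have [eta [Pe eta0]] : exists eta, S `<=` P eta /\ 0 < eta.
  apply: (@filter_ex _ 0^'+); apply: filterI near_P _; exact: nbhs_right_gt.
by exists eta => // s t /Pe; exact.
Qed.

Lemma compactly_supported_bounded (f : R -> R) :
  continuous f -> compactly_supported f ->
  exists2 B : R, 0 <= B & forall x, `|f x| <= B.
Proof.
move=> cf cs.
have cfs : {within closure [set x | f x != 0], continuous f}.
  exact: continuous_subspaceT.
have /compact_bounded[M [_ HM]] := continuous_compact cfs cs.
exists (`|M| + 1); first by rewrite addr_ge0.
move=> x; have [->|fx] := eqVneq (f x) 0; first by rewrite normr0 addr_ge0.
apply: (HM (`|M| + 1)) => /=; first by rewrite (le_lt_trans (ler_norm M)) // ltrDl.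
by exists x => //; apply: subset_closure.
Qed.

End UniformContinuity.

(** * Quantitative bound on the Nevai integral at one point *)

Section NevaiBound.
Context {R : realType}.

(** [ball_mass] feeds [Rintegral_concentrated] with the window of radius N/(2k). There the argument
    of [f] is within [eta] of [s]; elsewhere the difference of values of [f] is at most 2B. *)
Lemma Nevai_int_le (mu : nat -> probability (measurableTypeR R) R)
    (nu : {measure set (measurableTypeR R) -> \bar R}) (w : R -> R)
    (p : nat -> nat -> {poly R}) (alpha xs : R) (f : R -> R) (n N : nat)
    (s eps e B eta : R) :
  let x := Nevai_point alpha xs n s in
  let k := wCD w (p n) n x x in
  finite_moments (mu n) -> orthonormal_polys (mu n) (p n) ->
  lebesgue_decomposition (mu n) w nu ->
  (0 < n)%N -> (0 < N)%N -> 0 <= eps -> 0 <= e ->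
  continuous f -> (forall t, `|f t| <= B) ->
  (forall t, `|s - t| <= eta -> `|f s - f t| <= e) ->
  0 < k -> n%:R `^ alpha * (N%:R / (2 * k)) <= eta ->
  (forall b, `|b| <= N%:R / 2 ->
     `|rescaled (wCD w (p n) n) x 0 b - sinc_pi b| <= eps) ->
  `|Nevai_int mu p alpha xs f n s| <= e + 2 * B * (N%:R^-1 + 2 * N%:R * eps).
Proof.
move=> x k mom ortho dec n0 N0 eps0 e0 cf fB feta k0 keta sine.
have q0 : 0 < n%:R `^ alpha by rewrite powR_gt0 // ltr0n.
have B0 : 0 <= B by apply: le_trans (fB 0).
have K0 : 0 < CD (p n) n x x.
  have [_ w0 _ _] := dec.
  have := k0; rewrite /k wCD_diag //.
  by apply: contraTT; rewrite -!leNgt => K0; rewrite mulr_ge0_le0.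
set q := n%:R `^ alpha in q0 keta *.
set r := N%:R / (2 * k) in keta *.
rewrite /Nevai_int -/x -/q.
(* For fixed [x] the integrand is a polynomial in [y], so finite moments suffice. *)
have ig : (mu n).-integrable setT
    (EFin \o (fun y : measurableTypeR R => CD (p n) n x y ^+ 2 / CD (p n) n x x)).
  rewrite (_ : _ \o _ = fun y : measurableTypeR R =>
     ((CD (p n) n x x)^-1 *: (\sum_(j < n) (p n j).[x] *: p n j) ^+ 2).[y]%:E).
    exact: integrable_horner.
  apply/funext => y /=; congr EFin.
  by rewrite hornerZ horner_exp -CD_horner mulrC.
have gE (A : set (measurableTypeR R)) : measurable A ->
    ((CD (p n) n x x)%:E * \int[mu n]_(y in A) (CD (p n) n x y ^+ 2 / CD (p n) n x x)%:E =
    \int[mu n]_(y in A) (CD (p n) n x y ^+ 2)%:E)%E.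
  move=> mA; rewrite -integralZl //; last by apply: integrableS ig.
  by apply: eq_integral => y _; rewrite -EFinM mulrC divfK // gt_eqF.
have igE (A : set (measurableTypeR R)) : measurable A ->
    (\int[mu n]_(y in A) (CD (p n) n x y ^+ 2 / CD (p n) n x x)%:E =
    (\int[mu n]_(y in A) (CD (p n) n x y ^+ 2 / CD (p n) n x x)%R)%:E)%E.
  move=> mA; rewrite /Rintegral fineK //; apply: integrable_fin_num => //.
  exact: integrableS ig.
apply: (@Rintegral_concentrated _ _ _ (mu n)
   (fun y => CD (p n) n x y ^+ 2 / CD (p n) n x x)
   (fun y => f s - f (q * (y - xs))) `[x - r, x + r]%classic) => //.
- by move=> y; rewrite divr_ge0 ?sqr_ge0 // ltW.
- apply: continuous_measurable_fun => y; apply: cvgB; first exact: cvg_cst.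
  apply: (@continuous_comp _ _ _ (fun y => q * (y - xs)) f); last exact: cf.
  by apply: differentiable_continuous; exact/derivable1_diffP.
- move=> y; rewrite (le_trans (ler_normB _ _)) //.
  by have := fB s; have := fB (q * (y - xs)); lra.
- move=> y /=; rewrite in_itv /= => yr; apply: feta.
  have -> : s - q * (y - xs) = q * (x - y).
    by rewrite /x /Nevai_point -/q; field; rewrite gt_eqF.
  rewrite normrM gtr0_norm // (le_trans _ keta) // ler_pM2l //.
  by rewrite ler_norml; lra.
- by rewrite mulr_ge0.
(* Total mass 1: the squared kernel integrates to its diagonal value. *)
- have := gE _ measurableT; rewrite integral_CD_sqr // igE // -EFinM => -[].
  by move=> E; apply: (mulfI (negbT (gt_eqF K0))); rewrite mulr1.
- have mD : measurable (`[x - r, x + r]%classic : set (measurableTypeR R)).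
    exact: measurable_itv.
  rewrite -(ler_pM2l K0) -lee_fin [leRHS]EFinM -igE // gE //.
  rewrite (_ : 1 - _ = 1 - N%:R^-1 - 2 * N%:R * eps); last by ring.
  exact: (ball_mass dec).
Qed.

End NevaiBound.

(** * The diagonal outgrows n^alpha near the base point *)

Section Diagonal.
Context {R : realType}.

Lemma natr_powR_ge (b A : R) : 0 < b -> \forall n \near \oo, A <= n%:R `^ b.
Proof.
move=> b0; pose C := (`|A| + 1) `^ b^-1.
have A0 : 0 < `|A| + 1 by rewrite ltr_wpDl.
near=> n.
have Cn : C <= n%:R by near: n; exact: nbhs_infty_ger.
have : C `^ b <= n%:R `^ b by rewrite ge0_ler_powR ?nnegrE ?powR_ge0 // ltW.
rewrite /C -powRrM mulVf ?gt_eqF // powRr1; last exact: ltW.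
by move=> h; apply: le_trans h; have := ler_norm A; lra.
Unshelve. all: by end_near. Qed.

Variables (K : nat -> R -> R -> R) (I : set R) (xs rho alpha : R).
Hypothesis K_ge0 : forall n x, (0 < n)%N -> 0 <= K n x x.
Hypotheses (rho0 : 0 < rho) (alpha_lt1 : alpha < 1).
Hypothesis diag : forall e, 0 < e ->
  \forall n \near \oo, `|rho - K n xs xs / n%:R| < e.
Hypothesis sine : forall A : set R, compact A -> forall e, 0 < e ->
  \forall n \near \oo, forall x a, I x -> A a -> `|1 - rescaled (K n) x a a| < e.

(* If the diagonal were small at [x], then [xs] would lie within boundedly many
   multiples of [1 / K n x x] of [x], and the sine limit with [a = b] would make
   the diagonal small at [xs] too. *)
Lemma diagonal_large (L M : R) : 0 <= L -> 0 < M ->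
  \forall n \near \oo, forall x, I x -> n%:R `^ alpha * `|xs - x| <= L ->
    M * n%:R `^ alpha <= K n x x.
Proof.
move=> L0 M0; near=> n => x Ix xL.
have n0 : (0 < n)%N by near: n; exact: nbhs_infty_gt.
have sn : forall x a, I x -> `[- (L * M), L * M]%classic a ->
    `|1 - rescaled (K n) x a a| < 1 / 2.
  by near: n; apply: sine; [exact: segment_compact|lra].
have dn : `|rho - K n xs xs / n%:R| < rho / 2.
  by near: n; apply: diag; rewrite divr_gt0.
(* With this, rho n / 2 >= 2 M n^alpha, whereas a small diagonal at [x] would force rho n / 2 <
   K(xs, xs) < (3/2) M n^alpha. *)
have pn : 4 * M / rho <= n%:R `^ (1 - alpha).
  by near: n; apply: natr_powR_ge; rewrite subr_gt0.
have nE : n%:R = n%:R `^ alpha * n%:R `^ (1 - alpha) :> R.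
  rewrite -powRD; last by rewrite pnatr_eq0 -lt0n n0 implybT.
  by rewrite addrCA subrr addr0 powRr1.
have q0 : 0 < n%:R `^ alpha :> R by rewrite powR_gt0 // ltr0n.
have LM0 : 0 <= L * M by rewrite mulr_ge0 // ltW.
rewrite leNgt; apply/negP => kM.
(* If the diagonal vanished, division by 0 would give [rescaled] the value 0, which is not within
   1/2 of 1. *)
have k0 : 0 < K n x x.
  rewrite lt_def K_ge0 // andbT; apply/eqP => k0.
  have := sn x 0 Ix; rewrite /rescaled k0 invr0 !mulr0 subr0 normr1 /= in_itv /=.
  by rewrite oppr_le0 LM0 => /(_ isT); lra.
(* This [a] sends the rescaled point to [xs], so the sine limit compares K(xs, xs) with K(x, x). *)
have := sn x ((xs - x) * K n x x) Ix.
have E : (xs - x) * K n x x / K n x x = xs - x by rewrite mulfK // gt_eqF.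
rewrite /rescaled E (addrC x) subrK /= in_itv /= -ler_norml normrM (gtr0_norm k0).
have aL : `|xs - x| * K n x x <= L * M.
  apply: (@le_trans _ _ (`|xs - x| * (M * n%:R `^ alpha))).
    by rewrite ler_wpM2l // ltW.
  by rewrite mulrCA mulrC ler_pM2r // mulrC.
move=> /(_ aL); rewrite ltr_norml => /andP[+ _].
move: dn; rewrite ltr_norml => /andP[_].
rewrite ltrBlDr -ltrBlDl => dn kn.
have h1 : rho / 2 * n%:R < K n xs xs by rewrite -ltr_pdivlMr ?ltr0n //; lra.
have h2 : K n xs xs < 3 / 2 * K n x x by rewrite -ltr_pdivrMr //; lra.
have h3 : 4 * M <= n%:R `^ (1 - alpha) * rho by rewrite -ler_pdivrMr.
move: h1 h3 q0 kM ; rewrite {1}nE.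
set q := n%:R `^ alpha; set u := n%:R `^ _ => h1 h3 q0 kM.
have : q * (4 * M) <= q * (u * rho) by rewrite ler_pM2l.
nra.
Unshelve. all: by end_near. Qed.

End Diagonal.

(** * Choice of constants, uniformity in s, and the interior case *)

Theorem theorem5p4 (R : realType)
  (mu : nat -> probability (measurableTypeR R) R)
  (w : nat -> R -> R)
  (mu_sing : nat -> {measure set (measurableTypeR R) -> \bar R})
  (p : nat -> nat -> {poly R})
  (I : set R) (xstar : R) (rho : R -> R)
  (mu_moments : forall n, (0 < n)%N -> finite_moments (mu n))
  (mu_infinite : forall n, (0 < n)%N -> infinite_set (msupp (mu n)))
  (mu_decomp : forall n, (0 < n)%N ->
     lebesgue_decomposition (mu n) (w n) (mu_sing n))
  (p_orthonormal : forall n, (0 < n)%N -> orthonormal_polys (mu n) (p n))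
  (I_interval : is_interval I)
  (I_xstar : I xstar)
  (I_supp : forall n, (0 < n)%N -> I `<=` msupp (mu n))
  (sing_I : forall n, (0 < n)%N -> mu_sing n I = 0%E)
  (w_xstar : forall n, (0 < n)%N -> 0 < w n xstar)
  (rho_cont : {within I, continuous rho})
  (rho_xstar : 0 < rho xstar)
  (diag_limit :
     {uniform I, (fun (n : nat) (x : R) => wCD (w n) (p n) n x x / n%:R)
                   @ \oo --> rho})
  (sine_limit : forall A B : set R, compact A -> compact B ->
     {uniform I `*` (A `*` B),
        (fun (n : nat) (t : R * (R * R)) =>
           rescaled (wCD (w n) (p n) n) t.1 t.2.1 t.2.2) @ \oo -->
        (fun t : R * (R * R) => sinc_pi (t.2.2 - t.2.1))})
  (alpha : R) (alpha_ge0 : 0 <= alpha) (alpha_lt1 : alpha < 1) :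
  (0 < alpha -> (I°) xstar -> alpha_Nevai mu p alpha xstar) /\
  alpha_Nevai_in mu p I alpha xstar.
Proof.
have K_ge0 n x : (0 < n)%N -> 0 <= wCD (w n) (p n) n x x.
  move=> n0; have [_ w0 _ _] := mu_decomp n n0.
  by rewrite wCD_diag // mulr_ge0 // CD_diag_ge0.
have diag e : 0 < e -> \forall n \near \oo,
    `|rho xstar - wCD (w n) (p n) n xstar xstar / n%:R| < e.
  move=> e0; have := (uniform_cvg_normP _ _ _).1 diag_limit e e0.
  by apply: filterS => n; exact.
have sine A B e : compact A -> compact B -> 0 < e -> \forall n \near \oo,
    forall x a b, I x -> A a -> B b ->
    `|sinc_pi (b - a) - rescaled (wCD (w n) (p n) n) x a b| < e.
  move=> cA cB e0; have := (uniform_cvg_normP _ _ _).1 (sine_limit A B cA cB) e e0.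
  by apply: filterS => n H x a b Ix Aa Bb; exact: (H (x, (a, b))).
have large L M : 0 <= L -> 0 < M -> \forall n \near \oo, forall x, I x ->
    n%:R `^ alpha * `|xstar - x| <= L -> M * n%:R `^ alpha <= wCD (w n) (p n) n x x.
  apply: (@diagonal_large _ (fun n => wCD (w n) (p n) n) I xstar (rho xstar)) => //.
  (* Only the case a = b of the sine limit enters here, where the limit is sinc(0) = 1. *)
  move=> A cA e e0; have := sine A A e cA cA e0.
  apply: filterS => n H x a Ix Aa; have := H x a a Ix Aa Aa.
  by rewrite subrr /sinc_pi eqxx.
have main : alpha_Nevai_in mu p I alpha xstar.
  move=> f cf csf S cS e e0.
  have [B B0 fB] := @compactly_supported_bounded R f cf csf.
  have e4 : 0 < e / 4 by rewrite divr_gt0.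
  have [eta eta0 feta] := @compact_continuous_uniform R f S (e / 4) cf cS e4.
  have [L L0 SL] : exists2 L, 0 <= L & forall s, S s -> `|s| <= L.
    have [M [_ HM]] := compact_bounded cS.
    exists (`|M| + 1) => [|s Ss]; first by rewrite addr_ge0.
    by apply: (HM (`|M| + 1)) => //; rewrite (le_lt_trans (ler_norm M)) // ltrDl.
  (* The successor puts [N] strictly above 8B/e and makes it positive; this bounds the 1/N error by
     e/4. *)
  pose N := (Num.truncn (8 * B / e)).+1.
  have N0 : 0 < N%:R :> R by rewrite ltr0n.
  have NB : 2 * B / N%:R <= e / 4.
    have : 8 * B / e < N%:R by exact: truncnS_gt.
    by rewrite ltr_pdivrMr // ler_pdivrMr //; lra.
  (* Chosen after [N], since the sine error is multiplied by [N]; B + 1 avoids a zero denominator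
     when B = 0. *)
  pose eps := e / (16 * (B + 1) * N%:R).
  have eps0 : 0 < eps by rewrite divr_gt0 ?mulr_gt0 // ltr_wpDl.
  have NE : 2 * B * (2 * N%:R * eps) <= e / 4.
    have -> : 2 * B * (2 * N%:R * eps) = e / 4 * (B / (B + 1)).
      by rewrite /eps; field; rewrite !gt_eqF // ltr_wpDl.
    rewrite ler_piMr ?ltW // ltr_pdivrMr ?ltr_wpDl // mul1r; lra.
  (* A diagonal of at least this multiple of n^alpha shrinks the window, magnified by n^alpha, to
     radius at most [eta]. *)
  have M0 : 0 < N%:R / (2 * eta) by rewrite divr_gt0 ?mulr_gt0.
  have cN : compact `[- (N%:R / 2), N%:R / 2 : R]%classic by exact: segment_compact.
  near=> n => s Ss Is.
  have n0 : (0 < n)%N by near: n; exact: nbhs_infty_gt.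
  have q0 : 0 < n%:R `^ alpha by rewrite powR_gt0 // ltr0n.
  set x := Nevai_point alpha xstar n s in Is *.
  have kM : N%:R / (2 * eta) * n%:R `^ alpha <= wCD (w n) (p n) n x x.
    (* The left side is |s|, so [large] applies with one [n] for all [s] in [S]. *)
    have : n%:R `^ alpha * `|xstar - x| <= L.
      rewrite /x /Nevai_point opprD addrA subrr sub0r normrN normrM normfV.
      by rewrite (gtr0_norm q0) mulrC divfK ?gt_eqF // SL.
    by move: x Is; near: n; apply: large.
  have k0 : 0 < wCD (w n) (p n) n x x by apply: lt_le_trans kM; rewrite mulr_gt0.
  have sn b : `|b| <= N%:R / 2 ->
      `|rescaled (wCD (w n) (p n) n) x 0 b - sinc_pi b| <= eps.
    move=> bN; rewrite distrC -{1}(subr0 b); apply: ltW.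
    have sn y a c : I y -> [set 0] a -> `[- (N%:R / 2), N%:R / 2]%classic c ->
        `|sinc_pi (c - a) - rescaled (wCD (w n) (p n) n) y a c| < eps.
      by move: y a c; near: n; apply: sine => //; exact: compact_set1.
    by apply: sn => //; rewrite /= in_itv /= -ler_norml.
  have keta : n%:R `^ alpha * (N%:R / (2 * wCD (w n) (p n) n x x)) <= eta.
    have k20 : 0 < 2 * wCD (w n) (p n) n x x by exact: mulr_gt0.
    have eta20 : 0 < 2 * eta by exact: mulr_gt0.
    by rewrite mulrA ler_pdivrMr //; move: kM; rewrite mulrAC ler_pdivrMr //; lra.
  (* Three contributions of at most e/4: continuity of [f], the 1/N term and the sine error. *)
  have := @Nevai_int_le R mu (mu_sing n) (w n) p alpha xstar f n N s eps (e / 4) B eta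
    (mu_moments n n0) (p_orthonormal n n0) (mu_decomp n n0) n0 isT (ltW eps0) (ltW e4)
    cf fB (fun t => feta s t Ss) k0 keta sn.
  by move=> H; apply: le_lt_trans H _; rewrite mulrDr; lra.
(* For alpha > 0, n^alpha tends to infinity, so the evaluation points with [s] in the bounded set
   [S] all enter a ball around [xstar] inside [I]. *)
split=> // alpha0 xI f cf csf S cS.
apply/uniform_cvg_normP => e e0.
have [M [_ HM]] := compact_bounded cS.
have [del /= del0 Idel] : exists2 del : R, 0 < del & ball xstar del `<=` I.
  by move: xI => /nbhs_ballP[del /= del0 H]; exists del.
near=> n => s Ss; rewrite sub0r normrN.
have n0 : (0 < n)%N by near: n; exact: nbhs_infty_gt.
have q0 : 0 < n%:R `^ alpha by rewrite powR_gt0 // ltr0n.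
(* |s| is at most |M| + 1 on [S]; the extra 1 gives the strict inequality for the open ball. *)
have qL : (`|M| + 2) / del <= n%:R `^ alpha by near: n; exact: natr_powR_ge.
have small t : S t -> I (Nevai_point alpha xstar n t) ->
    `|Nevai_int mu p alpha xstar f n t| < e.
  by move: t; near: n; exact: main.
apply: small => //; apply: Idel; rewrite -ball_normE /= /Nevai_point.
rewrite opprD addrA subrr sub0r normrN normrM normfV (gtr0_norm q0).
rewrite ltr_pdivrMr // -ltr_pdivrMl // mulrC; apply: lt_le_trans qL.
rewrite ltr_pM2r ?invr_gt0 //; apply: (@le_lt_trans _ _ (`|M| + 1)); last by lra.
by apply: (HM (`|M| + 1)) => //; rewrite (le_lt_trans (ler_norm M)) // ltrDl.
Unshelve. all: by end_near.
Qed.
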